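(* Let $X$ be a diffeological space. The map $\imath:X\rightarrow\mathfrak{P}_{s}(X)$ defined by $\imath(x)=\{x\}$ is a strong embedding.
   Context: A parametrization in a set $X$ is a map $P:U\to X$ with $U$ an open subset of some $\mathbb{R}^n$ ($n\ge 0$). A diffeology on $X$ is a set of parametrizations in $X$ (called plots) that contains all constant parametrizations, is local, and is stable under precomposition with smooth maps between open subsets of Euclidean spaces. A map $f$ between diffeological spaces is smooth if $f\circ P$ is a plot for every plot $P$. A subset is D-open if its preimage under every plot is open; the D-open sets form the D-topology. Subsets carry the subset diffeology and products the product diffeology. Let $\mathcal{D}$ be the diffeology of $X$. A smooth family of plots in $X$ is a map $\rho:U\to\mathcal{D}$, $U$ open in a Euclidean space, such that for all $r_0\in U$ and all $s_0\in\mathrm{dom}(\rho(r_0))$ there exist an open neighborhood $V\subset U$ of $r_0$ and an open neighborhood $W$ of $s_0$ such that $W\subset\mathrm{dom}(\rho(r))$ for all $r\in V$ and $(r,s)\mapsto\rho(r)(s)$, defined on $V\times W$, is a plot in $X$. $\mathfrak{P}(X)$ is the set of all subsets of $X$. Strong power set diffeology: $P:U\to\mathfrak{P}(X)$ is a plot of $\mathfrak{P}_s(X)$ iff for every $r_0\in U$ and every plot $Q_0$ in $X$ with $\mathrm{Im}(Q_0)\subset P(r_0)$, there exist an open neighborhood $V\subset U$ of $r_0$ and a smooth family $\sigma:V\to\mathcal{D}$ of plots in $X$ such that $\mathrm{Im}(\sigma(r))\subset P(r)$ for every $r\in V$ and $\sigma(r_0)=Q_0$. An induction is an injective map $f:X\to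 Y$ such that a parametrization $P$ in $X$ is a plot iff $f\circ P$ is a plot in $Y$. For a smooth map $f:X\to Y$ and a plot $P:U\to Y$, let $P^*X=\{(r,x)\in U\times X\mid P(r)=f(x)\}$ and $P^*f:P^*X\to U$, $(r,x)\mapsto r$. A smooth map $f:X\to Y$ is a diffeological immersion if for every plot $P:U\to Y$ and every $(r_0,x_0)\in P^*X$ there exist a D-open neighborhood $O$ of $(r_0,x_0)$ in $P^*X$, an open neighborhood $V\subset U$ of $P^*f(O)$, and a smooth map $\rho:V\to U\times X$ such that $\rho\circ P^*f(r,x)=(r,x)$ for all $(r,x)\in O$. A strong embedding is a map which is an induction, a diffeological immersion, and a D-embedding (i.e. a topological embedding with respect to the D-topologies). *)

(* Defs.v *)
From HB Require Import structures.
From mathcomp Require Import all_boot all_order all_algebra.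
From mathcomp Require Import all_classical all_reals all_analysis.

Set Implicit Arguments.
Unset Strict Implicit.
Unset Printing Implicit Defensive.

Import Order.TTheory GRing.Theory Num.Theory.
Import numFieldNormedType.Exports.

Local Open Scope classical_set_scope.
Local Open Scope ring_scope.

(* [f] is of class C^k on [U] ([U] is open in all uses): the iterated
   directional derivatives of [f] of order < k are differentiable on [U], and
   those of order k are continuous there. Only the values of [f] on [U]
   matter, see [Ck_eq]. *)
Fixpoint Ck (R : realType) (V W : normedModType R) (k : nat) (U : set V)
    (f : V -> W) : Prop :=
  if k is j.+1 then
    (forall x, U x -> differentiable f x) /\ (forall v, Ck j U ('D_v f))
  else forall x, U x -> {for x, continuous f}.

Definition smooth_on (R : realType) (V W : normedModType R) (U : set V)
    (f : V -> W) : Prop := forall k, Ck k U f.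

Section Calculus.
Variable R : realType.
Implicit Types V W : normedModType R.

Lemma near_eq_differentiable V W (f g : V -> W) x :
  (\near x, f x = g x) -> differentiable f x -> differentiable g x.
Proof.
move=> fg df; have fgx := nbhs_singleton fg.
pose P (h : {linear V -> W}) := continuous h /\ forall y,
  g y = g (lim (nbhs x)) + h (y - lim (nbhs x))
        +o_(y \near x) (y - lim (nbhs x)).
have Pf : P ('d f x).
  split; first exact: diff_continuous.
  suff /funeqP : g = cst (g (lim (nbhs x))) + 'd f x \o center (lim (nbhs x))
    +o_x (center (lim (nbhs x))) by [].
  apply/eqaddoP => e e0; have [[_ /eqaddoP/(_ _ e0)]] := df.
  rewrite !lim_id//; apply: filterS2 fg => y fgy.
  by rewrite !fctE fgy fgx.
have Pg : P ('d g x) := getPex (ex_intro P _ Pf).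
by constructor; case: Pg => cg /funext.
Qed.

Lemma Ck_sub V W k (U U' : set V) (f : V -> W) :
  U `<=` U' -> Ck k U' f -> Ck k U f.
Proof.
elim: k f => [|k IH] f UU' /=; first by move=> H x /UU'/H.
by move=> [df H]; split=> [x /UU'/df|v]//; exact: IH (H v).
Qed.

Lemma Ck_cover V W k (U : set V) (f : V -> W) :
  (forall x, U x -> exists2 V, V x & Ck k V f) -> Ck k U f.
Proof.
elim: k f => [|k IH] f H /=; first by move=> x /H[V' Vx]; apply.
split=> [x /H[V' Vx [df _]]|v]; first exact: df.
by apply: IH => x /H[V' Vx [_ +]] => /(_ v); exists V'.
Qed.

Lemma Ck_eq V W k (U : set V) (f g : V -> W) : open U ->
  {in U, f =1 g} -> Ck k U f -> Ck k U g.
Proof.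
move=> oU; have near_fg (f0 g0 : V -> W) x :
    {in U, f0 =1 g0} -> U x -> \near x, f0 x = g0 x.
  move=> fg Ux; apply: filterS (open_nbhs_nbhs (conj oU Ux)) => y Uy.
  by apply: fg; rewrite inE.
elim: k f g => [|k IH] f g fg /=.
  move=> cf x Ux; rewrite /prop_for /continuous_at -(fg x) ?inE//.
  by apply: cvg_trans (cf x Ux); apply: near_eq_cvg; exact: near_fg.
move=> [df H]; split=> [x Ux|v].
  by apply: near_eq_differentiable (df x Ux); exact: near_fg.
apply: IH (H v) => x; rewrite inE => Ux; apply: near_eq_derive.
exact: near_fg.
Qed.

Lemma CkW V W k (U : set V) (f : V -> W) : Ck k.+1 U f -> Ck k U f.
Proof.
elim: k f => [|k IH] f [df H]; last by split=> // v; exact: IH.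
by move=> x /df/differentiable_continuous.
Qed.

Lemma Ck_cst V W k (U : set V) (a : W) : Ck k U (cst a).
Proof.
elim: k a => [|k IH] a; first by move=> x _; exact: cst_continuous.
split=> // v; rewrite (_ : 'D_v (cst a) = cst 0) //.
by apply/funext => x; rewrite derive_cst.
Qed.

Lemma Ck_linear V W k (U : set V) (f : {linear V -> W}) :
  continuous f -> Ck k U f.
Proof.
move=> cf; case: k => [|k]; first by move=> x _; exact: cf.
split=> [x _|v]; first exact: linear_differentiable.
rewrite (_ : 'D_v f = cst (f v)); first exact: Ck_cst.
by apply/funext => x; rewrite deriveE ?diff_lin//; exact: linear_differentiable.
Qed.

Lemma CkD V W k (U : set V) (f g : V -> W) : open U ->
  Ck k U f -> Ck k U g -> Ck k U (f + g).
Proof.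
move=> oU; elim: k f g => [|k IH] f g.
  by move=> cf cg x Ux; apply: continuousD; [exact: cf|exact: cg].
move=> [df Hf] [dg Hg]; split=> [x Ux|v].
  by apply: differentiableD; [exact: df|exact: dg].
apply: Ck_eq (IH _ _ (Hf v) (Hg v)) => // x; rewrite inE => Ux.
by rewrite deriveD //; apply: diff_derivable; [exact: df|exact: dg].
Qed.

Lemma Ck_sum V W k (U : set V) I (r : seq I) (f : I -> V -> W) : open U ->
  (forall i, Ck k U (f i)) -> Ck k U (\sum_(i <- r) f i).
Proof.
move=> oU Hf; elim/big_rec: _ => [|i g _]; first exact: Ck_cst.
exact: CkD.
Qed.

Lemma CkM V k (U : set V) (f g : V -> R) : open U ->
  Ck k U f -> Ck k U g -> Ck k U (f * g).
Proof.
move=> oU; elim: k f g => [|k IH] f g.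
  by move=> cf cg x Ux; apply: continuousM; [exact: cf|exact: cg].
move=> Cf Cg; have [df Hf] := Cf; have [dg Hg] := Cg; split=> [x Ux|v].
  by apply: differentiableM; [exact: df|exact: dg].
have := CkD oU (IH _ _ (CkW Cf) (Hg v)) (IH _ _ (CkW Cg) (Hf v)).
apply: Ck_eq => // x; rewrite inE => Ux.
by rewrite deriveM //; apply: diff_derivable; [exact: df|exact: dg].
Qed.

Lemma CkZl V W k (U : set V) (f : V -> R) (w : W) : open U ->
  Ck k U f -> Ck k U (fun x => f x *: w).
Proof.
move=> oU; elim: k f => [|k IH] f.
  by move=> cf x Ux; apply: (@continuous_comp _ _ _ f ( *:%R^~ w) x (cf x Ux)); exact: scalel_continuous.
move=> [df Hf]; split=> [x Ux|v].
  by apply: differentiableZl; exact: df.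
apply: Ck_eq (IH _ (Hf v)) => // x; rewrite inE => Ux.
rewrite !deriveE ?diffZl//; try exact: df.
by apply: differentiableZl; exact: df.
Qed.

Lemma Ck_mx V k (U : set V) m n (f : V -> 'M[R]_(m, n)) : open U ->
  Ck k U f <-> forall i j, Ck k U (fun x => f x i j : R).
Proof.
move=> oU; split=> [Cf i j|Cf].
  elim: k f Cf => [|k IH] f.
    by move=> cf x Ux; apply: (@continuous_comp _ _ _ f (fun M => M i j) x (cf x Ux)); exact: coord_continuous.
  move=> [df Hf]; split=> [x Ux|v].
    by apply: (@differentiable_comp _ _ _ _ f (fun M => M i j) x (df x Ux)); exact: differentiable_coord.
  apply: Ck_eq (IH _ (Hf v)) => // x; rewrite inE => Ux.
  by rewrite derive_mx ?mxE//; exact/diff_derivable/df.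
suff -> : f = \sum_i \sum_j (fun x => f x i j *: delta_mx i j).
  apply: Ck_sum => // i; apply: Ck_sum => // j.
  by apply: CkZl => //; exact: Cf.
apply/funext => x; rewrite [LHS]matrix_sum_delta fct_sumE.
by apply: eq_bigr => i _; rewrite fct_sumE.
Qed.

Lemma Ck_row_mx V k (U : set V) m n p (f : V -> 'M[R]_(m, n))
    (g : V -> 'M[R]_(m, p)) : open U ->
  Ck k U f -> Ck k U g -> Ck k U (fun x => row_mx (f x) (g x)).
Proof.
move=> oU /(Ck_mx _ _ oU) Cf /(Ck_mx _ _ oU) Cg; apply/Ck_mx => // i j.
have [c ->|c ->] := split_ordP j.
  by under eq_fun do rewrite row_mxEl; exact: Cf.
by under eq_fun do rewrite row_mxEr; exact: Cg.
Qed.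

Lemma Ck_comp V W k m (U : set V) (U' : set 'rV[R]_m)
    (f : V -> 'rV[R]_m) (g : 'rV[R]_m -> R) :
  open U -> U `<=` f @^-1` U' ->
  Ck k U f -> Ck k U' g -> Ck k U (g \o f).
Proof.
move=> oU UU'; elim: k g => [|k IH] g.
  by move=> cf cg x Ux; apply: (@continuous_comp _ _ _ f g x (cf x Ux)); exact/cg/UU'.
move=> Cf [dg Hg]; have [df Hf] := Cf; split=> [x Ux|v].
  by apply: differentiable_comp; [exact: df|exact/dg/UU'].
have C : Ck k U (\sum_(j < m) ((fun x => 'D_v f x 0 j) * ('D_(delta_mx 0 j) g \o f))).
  apply: Ck_sum => // j; apply: CkM => //; first exact: (iffLR (Ck_mx k ('D_v f) oU) (Hf v)).
  by apply: IH (Hg _); exact: CkW.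
apply: Ck_eq C => // x; rewrite inE => Ux.
have dfx := df x Ux; have dgx := dg _ (UU' x Ux).
rewrite deriveE; last exact: differentiable_comp.
rewrite diff_comp //= -(deriveE v dfx) fct_sumE.
have -> (w : 'rV[R]_m) : 'd g (f x) w = \sum_j w 0 j * 'd g (f x) (delta_mx 0 j).
  rewrite [in LHS](row_sum_delta w) linear_sum.
  by apply: eq_bigr => j _; rewrite linearZ.
by apply: eq_bigr => j _; rewrite -deriveE.
Qed.

Lemma smooth_on_comp V m n (U : set V) (U' : set 'rV[R]_m)
    (f : V -> 'rV[R]_m) (g : 'rV[R]_m -> 'rV[R]_n) :
  open U -> open U' -> U `<=` f @^-1` U' ->
  smooth_on U f -> smooth_on U' g -> smooth_on U (g \o f).
Proof.
move=> oU oU' UU' sf sg k; apply/Ck_mx => // i j.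
apply: (@Ck_comp _ V k m U U' f (fun y => g y i j)) => //.
by move: i j; apply/Ck_mx.
Qed.

End Calculus.

(* A partial map from R^n to X; it is a parametrization in X, with domain
   [dom P], when [dom P] is open. Since values outside the domain are all
   [None], Leibniz equality is equality of domains and of values. *)
Definition partial_map (R : realType) (n : nat) (X : Type) := 'rV[R]_n -> option X.

Definition dom (R : realType) n X (P : partial_map R n X) : set 'rV[R]_n :=
  [set r | P r <> None].

Definition parametrization (R : realType) n X (P : partial_map R n X) : Prop :=
  open (dom P).

Definition pimage (R : realType) n X (P : partial_map R n X) : set X :=
  [set x | exists r, P r = Some x].

Definition prestr (R : realType) n X (U : set 'rV[R]_n) (P : partial_map R n X) :
    partial_map R n X :=
  fun r => if r \in U then P r else None.

Definition pcomp (R : realType) n X Y (f : X -> Y) (P : partial_map R n X) :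
    partial_map R n Y :=
  fun r => omap f (P r).

Section PartialMaps.
Context {R : realType} {n : nat}.

Lemma dom_prestr X U (P : partial_map R n X) : dom (prestr U P) = U `&` dom P.
Proof.
apply/seteqP; split=> r; rewrite /dom /prestr /=; case: ifPn => //.
- by move=> /set_mem.
- by move=> _ [].
- by move=> /negP nU [/mem_set].
Qed.

Lemma prestrE X (U : set 'rV[R]_n) (P : partial_map R n X) r :
  U r -> prestr U P r = P r.
Proof. by move=> Ur; rewrite /prestr mem_set. Qed.

Lemma prestr_id X (P : partial_map R n X) : prestr (dom P) P = P.
Proof.
apply/funext => r; rewrite /prestr; case: ifPn => //.
by case E : (P r) => // /negP[]; rewrite inE /dom /= E.
Qed.

Lemma dom_pcomp X Y (f : X -> Y) (P : partial_map R n X) : dom (pcomp f P) = dom P.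
Proof. by apply/seteqP; split=> r; rewrite /dom /pcomp /=; case: (P r). Qed.

Lemma pcomp_prestr X Y (f : X -> Y) U (P : partial_map R n X) :
  pcomp f (prestr U P) = prestr U (pcomp f P).
Proof. by apply/funext => r; rewrite /pcomp /prestr; case: ifP. Qed.

End PartialMaps.

Record diffeology (R : realType) (X : Type) := Diffeology {
  plot : forall n, set (partial_map R n X);
  plot_open : forall n (P : partial_map R n X), plot P -> parametrization P;
  plot_cst : forall n (U : set 'rV[R]_n) (x : X), open U ->
    plot (prestr U (fun=> Some x));
  plot_local : forall n (P : partial_map R n X), parametrization P ->
    (forall r, dom P r -> exists V, [/\ open V, V r, V `<=` dom P &
       plot (prestr V P)]) -> plot P;
  plot_comp : forall n m (P : partial_map R n X) (U : set 'rV[R]_m)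
      (F : 'rV[R]_m -> 'rV[R]_n), plot P -> open U -> smooth_on U F ->
    U `<=` F @^-1` dom P -> plot (prestr U (P \o F)) }.

Arguments plot {R X} d {n}.

Definition smooth (R : realType) (X Y : Type) (DX : diffeology R X)
    (DY : diffeology R Y) (f : X -> Y) : Prop :=
  forall n (P : partial_map R n X), plot DX P -> plot DY (pcomp f P).

Definition Dopen (R : realType) (X : Type) (DX : diffeology R X) (O : set X)
    : Prop :=
  forall n (P : partial_map R n X), plot DX P ->
    open [set r | exists2 x, P r = Some x & O x].

Lemma plot_prestr (R : realType) X (DX : diffeology R X) n (P : partial_map R n X) V :
  plot DX P -> open V -> plot DX (prestr V P).
Proof.
move=> pP oV; have oVP : open (V `&` dom P).
  by apply: openI => //; exact: plot_open pP.
suff -> : prestr V P = prestr (V `&` dom P) (P \o id).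
  apply: (plot_comp pP) => [//|k|r []//].
  by apply: (@Ck_linear _ _ _ k _ idfun) => x; exact: cvg_id.
apply/funext => r; rewrite /prestr in_setI /=; case: (r \in V) => //=.
by rewrite -[LHS](congr1 (@^~ r) (prestr_id P)).
Qed.

Section Pullback.
Context {R : realType} {X Y : Type}.
Variables (DY : diffeology R Y) (f : X -> Y).

Definition pullback_plot n : set (partial_map R n X) := [set P | plot DY (pcomp f P)].

Fact pullback_open n (P : partial_map R n X) : pullback_plot P -> parametrization P.
Proof. by move=> /plot_open; rewrite /parametrization dom_pcomp. Qed.

Fact pullback_cst n (U : set 'rV[R]_n) (x : X) : open U ->
  pullback_plot (prestr U (fun=> Some x)).
Proof. by move=> oU; rewrite /pullback_plot /= pcomp_prestr; exact: plot_cst. Qed.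

Fact pullback_local n (P : partial_map R n X) : parametrization P ->
  (forall r, dom P r -> exists V, [/\ open V, V r, V `<=` dom P &
     pullback_plot (prestr V P)]) -> pullback_plot P.
Proof.
move=> oP H; apply: plot_local => [|r]; first by rewrite /parametrization dom_pcomp.
rewrite dom_pcomp => /H[V [oV Vr VP pV]]; exists V; split=> //.
by rewrite -pcomp_prestr.
Qed.

Fact pullback_comp n m (P : partial_map R n X) (U : set 'rV[R]_m)
    (F : 'rV[R]_m -> 'rV[R]_n) : pullback_plot P -> open U -> smooth_on U F ->
  U `<=` F @^-1` dom P -> pullback_plot (prestr U (P \o F)).
Proof.
move=> pP oU sF UF; rewrite /pullback_plot /= pcomp_prestr.
by apply: (plot_comp pP) => //; rewrite dom_pcomp.
Qed.

Definition pullback_diffeology : diffeology R X :=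
  Diffeology pullback_open pullback_cst pullback_local pullback_comp.

End Pullback.

Definition subset_diffeology (R : realType) (X : Type) (DX : diffeology R X)
    (A : set X) : diffeology R A :=
  pullback_diffeology DX (fun a : A => val a).

Section Product.
Context {R : realType} {X Y : Type}.
Variables (DX : diffeology R X) (DY : diffeology R Y).

Definition product_plot n : set (partial_map R n (X * Y)) :=
  [set P | plot DX (pcomp fst P) /\ plot DY (pcomp snd P)].

Fact product_open n (P : partial_map R n (X * Y)) : product_plot P -> parametrization P.
Proof. by move=> [/plot_open + _]; rewrite /parametrization dom_pcomp. Qed.

Fact product_cst n (U : set 'rV[R]_n) (x : X * Y) : open U ->
  product_plot (prestr U (fun=> Some x)).
Proof.
by move=> oU; rewrite /product_plot /= !pcomp_prestr; split; exact: plot_cst.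
Qed.

Fact product_local n (P : partial_map R n (X * Y)) : parametrization P ->
  (forall r, dom P r -> exists V, [/\ open V, V r, V `<=` dom P &
     product_plot (prestr V P)]) -> product_plot P.
Proof.
move=> oP H; split; apply: plot_local => [|r]; rewrite ?/parametrization ?dom_pcomp//.
  move=> /H[V [oV Vr VP [pV _]]]; exists V; split=> //.
  by rewrite -pcomp_prestr.
move=> /H[V [oV Vr VP [_ pV]]]; exists V; split=> //.
by rewrite -pcomp_prestr.
Qed.

Fact product_comp n m (P : partial_map R n (X * Y)) (U : set 'rV[R]_m)
    (F : 'rV[R]_m -> 'rV[R]_n) : product_plot P -> open U -> smooth_on U F ->
  U `<=` F @^-1` dom P -> product_plot (prestr U (P \o F)).
Proof.
move=> [p1 p2] oU sF UF; rewrite /product_plot /= !pcomp_prestr.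
by split; [apply: (plot_comp p1)|apply: (plot_comp p2)] => //; rewrite dom_pcomp.
Qed.

Definition product_diffeology : diffeology R (X * Y) :=
  Diffeology product_open product_cst product_local product_comp.

End Product.

Section Euclidean.
Context {R : realType} {p : nat}.

Definition euclidean_plot n : set (partial_map R n 'rV[R]_p) :=
  [set P | parametrization P /\ smooth_on (dom P) (fun r => odflt 0 (P r))].

Fact euclidean_open n (P : partial_map R n 'rV[R]_p) : euclidean_plot P -> parametrization P.
Proof. by case. Qed.

Fact euclidean_cst n (U : set 'rV[R]_n) (x : 'rV[R]_p) : open U ->
  euclidean_plot (prestr U (fun=> Some x)).
Proof.
move=> oU; have dE : dom (prestr U (fun=> Some x)) = U.
  by rewrite dom_prestr; apply/setIidl => r.
split; rewrite /parametrization dE // => k.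
by apply: Ck_eq (Ck_cst k U x) => // r /set_mem Ur; rewrite prestrE.
Qed.

Fact euclidean_local n (P : partial_map R n 'rV[R]_p) : parametrization P ->
  (forall r, dom P r -> exists V, [/\ open V, V r, V `<=` dom P &
     euclidean_plot (prestr V P)]) -> euclidean_plot P.
Proof.
move=> oP H; split=> // k; apply: Ck_cover => r /H[V [oV Vr VP [_ sV]]].
exists V => //; move: (sV k); rewrite dom_prestr (setIidl VP).
by apply: Ck_eq => // s /set_mem Vs; rewrite prestrE.
Qed.

Fact euclidean_comp n m (P : partial_map R n 'rV[R]_p) (U : set 'rV[R]_m)
    (F : 'rV[R]_m -> 'rV[R]_n) : euclidean_plot P -> open U -> smooth_on U F ->
  U `<=` F @^-1` dom P -> euclidean_plot (prestr U (P \o F)).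
Proof.
move=> [oP sP] oU sF UF; have dE : dom (prestr U (P \o F)) = U.
  by rewrite dom_prestr; exact/setIidl.
split; rewrite /parametrization dE // => k.
have := smooth_on_comp oU oP UF sF sP k.
by apply: Ck_eq => // r /set_mem Ur; rewrite prestrE.
Qed.

(* The standard diffeology of R^p; the extension of plots by 0 outside of
   their (open) domain is irrelevant. *)
Definition euclidean_diffeology : diffeology R 'rV[R]_p :=
  Diffeology euclidean_open euclidean_cst euclidean_local euclidean_comp.

End Euclidean.

Arguments euclidean_diffeology R p : clear implicits.

Definition domain_diffeology (R : realType) (n : nat) (U : set 'rV[R]_n) :
    diffeology R U := subset_diffeology (euclidean_diffeology R n) U.

Definition any_partial_map (R : realType) (X : Type) := {n : nat & partial_map R n X}.

(* The value of [P] at [s]; it is undefined also when [s] is not in the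
   Euclidean space on which [P] is defined. *)
Definition peval (R : realType) (X : Type) (P : any_partial_map R X) (m : nat)
    (s : 'rV[R]_m) : option X := untag None (fun Q : partial_map R m X => Q s) P.

Lemma peval_Tagged (R : realType) X m (Q : partial_map R m X) (s : 'rV[R]_m) :
  peval (Tagged (fun n => partial_map R n X) Q) s = Q s.
Proof. by rewrite /peval (untagE _ _ (erefl m : tag (Tagged (fun n => partial_map R n X) Q) = m)). Qed.

(* A smooth family of plots rho : U -> D; only the values of [rho] on [U]
   matter, and a pair (r, s) is the row vector with blocks r and s. *)
Definition smooth_family (R : realType) (X : Type) (DX : diffeology R X)
    (n : nat) (U : set 'rV[R]_n) (rho : 'rV[R]_n -> any_partial_map R X) : Prop :=
  (forall r, U r -> plot DX (tagged (rho r))) /\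
  forall r0, U r0 -> forall s0, dom (tagged (rho r0)) s0 ->
    exists (V : set 'rV[R]_n) (W : set 'rV[R]_(tag (rho r0))),
      [/\ open V, V r0 & V `<=` U] /\ [/\ open W, W s0,
        (forall r s, V r -> W s -> peval (rho r) s <> None) &
        plot DX (prestr [set z | V (lsubmx z) /\ W (rsubmx z)]
                   (fun z => peval (rho (lsubmx z)) (rsubmx z)))].


Section StrongPowerset.
Context {R : realType} {X : Type}.
Variable DX : diffeology R X.

Definition strong_plot n : set (partial_map R n (set X)) :=
  [set P | parametrization P /\
    forall r0 A0, P r0 = Some A0 ->
    forall m (Q0 : partial_map R m X), plot DX Q0 -> pimage Q0 `<=` A0 ->
    exists V : set 'rV[R]_n, [/\ open V, V r0 & V `<=` dom P] /\
    exists sigma : 'rV[R]_n -> any_partial_map R X,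
      [/\ smooth_family DX V sigma,
          (forall r A, V r -> P r = Some A -> pimage (tagged (sigma r)) `<=` A) &
          sigma r0 = Tagged (fun n => partial_map R n X) Q0]].

Fact strong_powerset_open n (P : partial_map R n (set X)) :
  strong_plot P -> parametrization P.
Proof. by case. Qed.

Let openX n m (V : set 'rV[R]_n) (W : set 'rV[R]_m) : open V -> open W ->
  open [set z : 'rV[R]_(n + m) | V (lsubmx z) /\ W (rsubmx z)].
Proof.
move=> oV oW.
have oV' : open (@lsubmx R 1 n m @^-1` V).
  by apply: open_comp oV => z _; exact: continuous_lsubmx.
have oW' : open (@rsubmx R 1 n m @^-1` W).
  by apply: open_comp oW => z _; exact: continuous_rsubmx.
exact: openI oV' oW'.
Qed.

Fact strong_powerset_cst n (U : set 'rV[R]_n) (A : set X) : open U ->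
  strong_plot (prestr U (fun=> Some A)).
Proof.
move=> oU; have dE : dom (prestr U (fun=> Some A)) = U.
  by rewrite dom_prestr; apply/setIidl => r.
split=> [|r0 A0]; first by rewrite /parametrization dE.
rewrite /prestr; case: ifPn => // /set_mem Ur0 [<-] m Q0 pQ QA.
exists U; split; first by rewrite dE; split.
exists (fun=> Tagged (fun n => partial_map R n X) Q0); split=> //; last first.
  by move=> r A' Ur; case: ifP => // _ [<-].
have E (s : 'rV[R]_m) :
    peval (Tagged (fun n => partial_map R n X) Q0) s = Q0 s by exact: peval_Tagged.
split=> // r Ur /= s0 Qs0; exists U, (dom Q0); split=> //; split=> //.
- exact: plot_open pQ.
- by move=> r' s _ Ws; rewrite [peval _ _]E.
set f := (f in prestr _ f).
have -> : f = Q0 \o rsubmx by apply/funext => z; exact: E.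
apply: (plot_comp pQ) => [|k|z []//]; first exact: openX oU (plot_open pQ).
by apply: Ck_linear; exact: continuous_rsubmx.
Qed.

Fact strong_powerset_local n (P : partial_map R n (set X)) : parametrization P ->
  (forall r, dom P r -> exists V, [/\ open V, V r, V `<=` dom P &
     strong_plot (prestr V P)]) -> strong_plot P.
Proof.
move=> oP H; split=> // r0 A0 Pr0 m Q0 pQ QA.
have [|V [oV Vr VP [_ sV]]] := H r0; first by rewrite /dom /= Pr0.
have [|V' [[oV' V'r V'P] [sigma [fs ss s0]]]] := sV r0 A0 _ m Q0 pQ QA.
  by rewrite prestrE.
exists V'; split; first by split=> // r /V'P; rewrite dom_prestr => -[].
exists sigma; split=> // r A V'r' Pr; apply: ss => //.
by rewrite prestrE //; move/V'P : V'r'; rewrite dom_prestr => -[].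
Qed.

Fact strong_powerset_comp n m (P : partial_map R n (set X)) (U : set 'rV[R]_m)
    (F : 'rV[R]_m -> 'rV[R]_n) : strong_plot P -> open U -> smooth_on U F ->
  U `<=` F @^-1` dom P -> strong_plot (prestr U (P \o F)).
Proof.
move=> [oP sP] oU sF UF; have dE : dom (prestr U (P \o F)) = U.
  by rewrite dom_prestr; exact/setIidl.
have oUF B : open B -> open (U `&` F @^-1` B).
  move=> oB; rewrite openE => x [Ux Bx]; apply: filterI.
    exact: open_nbhs_nbhs.
  by apply: (sF 0%N x Ux); exact: open_nbhs_nbhs.
split=> [|r0 A0]; first by rewrite /parametrization dE.
rewrite {1}/prestr; case: ifPn => // /set_mem Ur0 PA0 k Q0 pQ QA.
have [V [[oV Vr VP] [sigma [[ps fs] ss s0]]]] := sP _ _ PA0 _ _ pQ QA.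
exists (U `&` F @^-1` V); rewrite dE; split.
  by split; [exact: oUF|split|move=> ? []].
exists (sigma \o F); split=> //; last first.
  by move=> r A [Ur VFr]; rewrite prestrE //; exact: ss.
split=> [r [Ur VFr]|r1 [Ur1 Vr1] s1 ds1]; first exact: ps.
have [V1 [W1 [[oV1 V1r V1V] [oW1 W1s V1W p1]]]] := fs _ Vr1 _ ds1.
exists (U `&` F @^-1` V1), W1; split.
  by split; [exact: oUF|split|move=> r [Ur /V1V]].
split=> //; first by move=> r s [Ur V1Fr]; exact: V1W.
pose p := tag (sigma (F r1)).
pose S : set 'rV[R]_(m + p) :=
  [set z | (U `&` F @^-1` V1) (lsubmx z) /\ W1 (rsubmx z)].
pose G (z : 'rV[R]_(m + p)) : 'rV[R]_(n + p) := row_mx (F (lsubmx z)) (rsubmx z).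
pose q (z : 'rV[R]_(m + p)) := peval (sigma (F (lsubmx z))) (rsubmx z).
suff: plot DX (prestr S q) by [].
have oS : open S by apply: openX => //; exact: oUF.
have SU : S `<=` lsubmx @^-1` U by move=> z [[]].
suff -> : prestr S q =
    prestr S (prestr [set z | V1 (lsubmx z) /\ W1 (rsubmx z)]
      (fun z => peval (sigma (lsubmx z)) (rsubmx z)) \o G).
  apply: (plot_comp p1) => //; last first.
    move=> z [[_ V1z] W1z]; rewrite /= dom_prestr /= /G row_mxKl row_mxKr.
    by split=> //; rewrite /dom /= row_mxKl row_mxKr; exact: V1W.
  move=> j; apply: Ck_row_mx => //; last first.
    by apply: Ck_linear; exact: continuous_rsubmx.
  apply: (smooth_on_comp oS oU SU) => // i.
  by apply: Ck_linear; exact: continuous_lsubmx.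
apply/funext => z; rewrite /prestr; case: ifPn => // /set_mem[[Uz V1z] W1z] /=.
by rewrite mem_set /= /G !row_mxKl row_mxKr.
Qed.

Definition strong_powerset_diffeology : diffeology R (set X) :=
  Diffeology strong_powerset_open strong_powerset_cst strong_powerset_local
    strong_powerset_comp.

End StrongPowerset.

Section Maps.
Context {R : realType} {X Y : Type}.
Variables (DX : diffeology R X) (DY : diffeology R Y) (f : X -> Y).

Definition is_induction : Prop :=
  injective f /\
  forall n (P : partial_map R n X), parametrization P ->
    (plot DX P <-> plot DY (pcomp f P)).

Definition fiber_product n (P : partial_map R n Y) : set (dom P * X)%type :=
  [set z | P (val z.1) = Some (f z.2)].
Arguments fiber_product {n} P.

Definition fiber_product_diffeology n (P : partial_map R n Y) :
    diffeology R (fiber_product P) :=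
  subset_diffeology (product_diffeology (domain_diffeology (dom P)) DX)
    (fiber_product P).

Definition fiber_proj n (P : partial_map R n Y) (z : fiber_product P) : 'rV[R]_n :=
  val (val z).1.

Definition diffeological_immersion : Prop :=
  smooth DX DY f /\
  forall n (P : partial_map R n Y), plot DY P -> forall z0 : fiber_product P,
    exists O : set (fiber_product P),
      [/\ Dopen (fiber_product_diffeology P) O, O z0 &
       exists V : set 'rV[R]_n,
         [/\ open V, V `<=` dom P, (@fiber_proj n P) @` O `<=` V &
          exists rho : V -> (dom P * X)%type,
            smooth (domain_diffeology V)
              (product_diffeology (domain_diffeology (dom P)) DX) rho /\
            forall z, O z -> forall r : V, val r = fiber_proj z ->
              rho r = val z]].

(* Topological embedding for the D-topologies: injective, continuous, and open
   onto the image, the latter with the topology induced by that of Y. *)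
Definition D_embedding : Prop :=
  [/\ injective f,
      (forall O, Dopen DY O -> Dopen DX (f @^-1` O)) &
      (forall O, Dopen DX O ->
         exists2 O', Dopen DY O' & f @` O = range f `&` O')].

Definition strong_embedding : Prop :=
  [/\ is_induction, diffeological_immersion & D_embedding].

End Maps.

(* Main.v *)
Require Import Defs.
From mathcomp Require Import all_boot all_order all_algebra.
From mathcomp Require Import all_classical all_reals all_analysis.

Local Open Scope classical_set_scope.

(** A point [x0] of [P r0], seen as a plot on R^0, spreads by the
definition of the strong power set diffeology to a smooth family of plots in
the sets [P r]; evaluating it at the point of R^0 gives a smooth local
selection of [P] through [(r0, x0)]. When the sets [P r] are singletons, this
selection is forced: this shows that singletons form an induction and an
immersion. Selections also show that the sets meeting a given D-open set of
[X] form a D-open set of the power set. *)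

Import numFieldNormedType.Exports.

Lemma smooth_on_id (R : realType) (V : normedModType R) (U : set V) :
  smooth_on U (idfun : V -> V).
Proof. by move=> k; apply: (Ck_linear k U (f := idfun)) => x; exact: cvg_id. Qed.

Lemma smooth_Dcontinuous (R : realType) (X Y : Type) (DX : diffeology R X)
    (DY : diffeology R Y) (f : X -> Y) (O : set Y) :
  smooth DX DY f -> Dopen DY O -> Dopen DX (f @^-1` O).
Proof.
move=> sf oO n P /sf/oO; congr open; apply/seteqP; rewrite /Defs.pcomp.
split=> r [y] /=; last by move=> -> Oy; exists (f y).
by case: (P r) => [x|]//= [<-] Oy; exists x.
Qed.

Lemma Dopen_euclidean (R : realType) (n : nat) (V : set 'rV[R]_n) :
  open V -> Dopen (euclidean_diffeology R n) V.
Proof.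
move=> oV m P [oP /(_ 0%N) cP]; rewrite openE => s [r Ps Vr].
have dPs : dom P s by rewrite /dom /= Ps.
have nV : nbhs (odflt 0%R (P s)) V by rewrite Ps; exact: open_nbhs_nbhs.
(* Continuity concerns the extension of [P] by 0; intersecting with the open set [dom P] keeps only
   the points where that extension is the value of [P]. *)
apply: filterS2 (open_nbhs_nbhs (conj oP dPs)) (cP s dPs _ nV) => t.
by rewrite /dom /=; case: (P t) => [y|]// _ Vy; exists y.
Qed.

Lemma smooth_fiber_proj (R : realType) (X Y : Type) (DX : diffeology R X)
    (f : X -> Y) (n : nat) (P : partial_map R n Y) :
  smooth (fiber_product_diffeology DX f P) (euclidean_diffeology R n)
    (@fiber_proj _ _ _ f n P).
Proof.
move=> m p [pp _].
suff -> : Defs.pcomp (@fiber_proj _ _ _ f n P) p =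
  Defs.pcomp val (Defs.pcomp fst (Defs.pcomp val p)) by [].
by apply/funext => s; rewrite /Defs.pcomp; case: (p s).
Qed.

Lemma pimage_peval (R : realType) (X : Type) (Q : any_partial_map R X) (m : nat)
    (s : 'rV[R]_m) (x : X) : peval Q s = Some x -> pimage (tagged Q) x.
Proof.
case: Q => k Q; case: (eqVneq k m) => [km|kNm].
  by subst m; rewrite peval_Tagged => Qs; exists s.
(* In a wrong dimension [peval] takes its default [None], against the hypothesis. *)
by rewrite /peval /untag; case: eqP => //= km; rewrite km eqxx in kNm.
Qed.

Lemma peval_tagged (R : realType) (X : Type) (Q : any_partial_map R X)
    (s : 'rV[R]_(tag Q)) : peval Q s = tagged Q s.
Proof. by case: Q s => m Q s; exact: peval_Tagged. Qed.

(** Near [(r0, s0)] the family is a plot in both variables jointly; precomposing it with the smooth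
    slice [r] to [(r, s0)] freezes the second one. *)
Lemma smooth_family_eval (R : realType) (X : Type) (DX : diffeology R X)
    (n : nat) (U : set 'rV[R]_n) (rho : 'rV[R]_n -> any_partial_map R X)
    (r0 : 'rV[R]_n) (s0 : 'rV[R]_(tag (rho r0))) :
  smooth_family DX U rho -> U r0 -> dom (tagged (rho r0)) s0 ->
  exists q : partial_map R n X, [/\ plot DX q, dom q `<=` U,
    q r0 = tagged (rho r0) s0 &
    forall r x, q r = Some x -> pimage (tagged (rho r)) x].
Proof.
move=> [_ srho] Ur0 /(srho _ Ur0)[V [W [[oV Vr0 VU] [oW Ws0 VW pE]]]].
exists (prestr V (fun r => peval (rho r) s0)); split.
- set E := prestr _ _ in pE.
  have -> : prestr V (fun r => peval (rho r) s0) =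
      prestr V (E \o (fun r => row_mx r s0)).
    apply/funext => r; rewrite /prestr; case: ifPn => // /set_mem Vr /=.
    rewrite /E prestrE ?row_mxKl ?row_mxKr//=.
    by split; rewrite ?row_mxKl ?row_mxKr.
  apply: plot_comp => // [k|r Vr].
    by apply: Ck_row_mx; [|exact: smooth_on_id|exact: Ck_cst].
  rewrite /= /E dom_prestr; split; rewrite /= /dom /= ?row_mxKl ?row_mxKr//.
  exact: VW.
- by move=> r; rewrite dom_prestr => -[/VU].
- by rewrite prestrE// peval_tagged.
- by move=> r x; rewrite /prestr; case: ifP => // _; exact: pimage_peval.
Qed.

Lemma strong_plot_selection (R : realType) (X : Type) (DX : diffeology R X)
    (n : nat) (P : partial_map R n (set X)) (r0 : 'rV[R]_n) (A0 : set X) (x0 : X) :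
  plot (strong_powerset_diffeology DX) P -> P r0 = Some A0 -> A0 x0 ->
  exists q : partial_map R n X, [/\ plot DX q, dom q `<=` dom P,
    q r0 = Some x0 & forall r x A, q r = Some x -> P r = Some A -> A x].
Proof.
move=> [_ sP] Pr0 A0x0.
pose Q0 : partial_map R 0 X := prestr setT (fun=> Some x0).
have Q0E s : Q0 s = Some x0 by rewrite /Q0 prestrE.
have pQ0 : plot DX Q0 by apply: plot_cst; exact: openT.
have Q0A : pimage Q0 `<=` A0 by move=> x [s]; rewrite Q0E => -[<-].
have [V [[_ Vr0 VP] [sigma [fs ss s0]]]] := sP _ _ Pr0 _ _ pQ0 Q0A.
(* [tag (sigma r0)] is 0 only propositionally, so the point of R^0 is transported along [s0]. *)
have [s1 s1E] : exists s1, tagged (sigma r0) s1 = Some x0.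
  by rewrite s0; exists 0%R; exact: Q0E.
have [|q [pq qV qr0 qs]] := smooth_family_eval _ _ _ _ _ _ _ s1 fs Vr0.
  by rewrite /dom /= s1E.
exists q; split=> // [r /qV/VP//||r x A qr Pr]; first by rewrite qr0.
by apply: ss (qs _ _ qr) => //; apply: qV; rewrite /dom /= qr.
Qed.

Lemma smooth_set1 (R : realType) (X : Type) (DX : diffeology R X) :
  smooth DX (strong_powerset_diffeology DX) (fun x : X => [set x]).
Proof.
move=> n P pP; split=> [|r0 A0 Pr0 m Q0 pQ0 Q0A0].
  by rewrite /parametrization dom_pcomp; exact: plot_open pP.
have oP := plot_open pP; have oQ0 := plot_open pQ0.
exists (dom P); rewrite dom_pcomp; split.
  by split=> //; move: Pr0; rewrite /Defs.pcomp /dom /=; case: (P r0).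
(* [Q0] is constant, so it extends to the family of the constant plots with
   value [P r] on the domain of [Q0]. *)
pose sigma (r : 'rV[R]_n) : any_partial_map R X :=
  Tagged (fun k => partial_map R k X) (prestr (dom Q0) (fun=> P r)).
exists sigma; split; last 2 first.
- move=> r A _ PrA x [s]; rewrite /= /prestr; case: ifP => // _ Prx.
  by move: PrA; rewrite /Defs.pcomp Prx => -[<-].
- congr Tagged; apply/funext => s; rewrite /prestr; case: ifPn.
    rewrite inE /dom /=; case Q0s : (Q0 s) => [y|]// _.
    have : A0 y by apply: Q0A0; exists s.
    by move: Pr0; rewrite /Defs.pcomp; case: (P r0) => //= x [<-] ->.
  by rewrite notin_setE => /contrapT.
split=> [r|r1 Pr1 s1 /=].
  by rewrite /dom /=; case Pr : (P r) => [x|]// _; exact: plot_cst.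
rewrite dom_prestr => -[Q0s1 _].
have sigmaE r (s : 'rV[R]_m) : peval (sigma r) s = prestr (dom Q0) (fun=> P r) s.
  exact: peval_Tagged.
exists (dom P), (dom Q0); split=> //; split=> // [r s Pr Q0s|].
  by rewrite [peval _ _]sigmaE prestrE.
set S := (S in prestr S _).
have oS : open S.
  apply: (@openI _ (@lsubmx R 1 n m @^-1` dom P) (@rsubmx R 1 n m @^-1` dom Q0)).
    by apply: open_comp oP => z _; exact: continuous_lsubmx.
  by apply: open_comp oQ0 => z _; exact: continuous_rsubmx.
(* On [S] the family forgets the right block, so it is [P] after a linear projection. *)
have -> : prestr S (fun z => peval (sigma (lsubmx z)) (rsubmx z)) =
    prestr S (P \o lsubmx).
  apply/funext => z; rewrite /(prestr S); case: ifP => // /set_mem[_ Q0z].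
  by rewrite [peval _ _]sigmaE prestrE.
apply: plot_comp => // [k|z []//].
by apply: Ck_linear; exact: continuous_lsubmx.
Qed.

Lemma is_induction_set1 (R : realType) (X : Type) (DX : diffeology R X) :
  is_induction DX (strong_powerset_diffeology DX) (fun x : X => [set x]).
Proof.
split=> [x y /seteqP[xy _]|n P oP]; first exact: xy.
split=> [|sP]; first exact: smooth_set1.
apply: plot_local => // r; rewrite {1}/dom /=; case Pr : (P r) => [x|]// _.
have [||q [pq qP qr qs]] := strong_plot_selection _ _ _ _ _ r [set x] x sP.
- by rewrite /Defs.pcomp Pr.
- by [].
exists (dom q); split=> //; first exact: plot_open pq.
- by rewrite /dom /= qr.
- by move: qP; rewrite dom_pcomp.
(* Where [q] is defined, its value lies in the singleton of the value of [P]; hence [q] is a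
   restriction of [P] around [r]. *)
suff -> : prestr (dom q) P = q by [].
apply/funext => s; rewrite -[RHS](congr1 (@^~ s) (prestr_id q)) /prestr.
case: ifP => // /set_mem qds; have := qP _ qds; have := qds.
rewrite dom_pcomp /dom /=; case qsE : (q s) => [y|]// _.
case Ps : (P s) => [z|]// _; congr Some; apply/esym.
by apply: (qs s y [set z]) => //; rewrite /Defs.pcomp Ps.
Qed.

Lemma diffeological_immersion_set1 (R : realType) (X : Type) (DX : diffeology R X) :
  diffeological_immersion DX (strong_powerset_diffeology DX)
    (fun x : X => [set x]).
Proof.
split=> [|n P sP z0]; first exact: smooth_set1.
have [q [pq qP qz0 qs]] := strong_plot_selection _ _ _ _ _ _ _ (val z0).2 sP
  (set_valP z0) erefl.
have oq := plot_open pq.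
(* These are the points of the fiber product lying over the domain of the selection [q] through
   [z0]; the left inverse [rho] will be [r] to [(r, q r)]. *)
exists (fun z => dom q (fiber_proj z)); split.
- exact: smooth_Dcontinuous (smooth_fiber_proj _ _ _ DX _ _ P) (Dopen_euclidean _ _ _ oq).
- by rewrite /dom /= /fiber_proj qz0.
exists (dom q); split=> // [r [z qz <-]//|].
(* [choice] serves only to bundle [r] with a proof that it lies in [dom P]. *)
have /choice[rho rhoE] : forall r : dom q, exists z : (dom P * X)%type,
    val z.1 = val r /\ q (val r) = Some z.2.
  move=> r; have := set_valP r; rewrite {1}/dom /=.
  case qr : (q (val r)) => [x|]// _.
  by exists (exist _ (val r) (mem_set (qP _ (set_valP r))), x).
exists rho; split=> [k p pp|z qz r rz].
  split.
    rewrite /= /pullback_plot /=.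
    suff -> : Defs.pcomp val (Defs.pcomp fst (Defs.pcomp rho p)) = Defs.pcomp val p by [].
    apply/funext => s; rewrite /Defs.pcomp; case: (p s) => //= r.
    by rewrite (rhoE r).1.
  (* The second component of [rho] along [p] is [q] precomposed with the coordinates of [p], smooth
     on [dom p]; the default 0 occurs only outside [dom p]. *)
  have op := plot_open pp; have [_] := pp; rewrite dom_pcomp => sp.
  have -> : Defs.pcomp snd (Defs.pcomp rho p) =
      prestr (dom p) (q \o (fun s => odflt 0%R (Defs.pcomp val p s))).
    apply/funext => s; rewrite /Defs.pcomp /prestr; case: ifPn.
      by rewrite inE /dom /=; case: (p s) => //= r _; rewrite (rhoE r).2.
    by rewrite notin_setE => /contrapT ->.
  apply: plot_comp => // s; rewrite /= /Defs.pcomp {1}/dom /=.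
  by case: (p s) => //= r _; exact: (set_valP r).
have [rho1 rho2] := rhoE r.
rewrite [LHS]surjective_pairing [RHS]surjective_pairing; congr pair.
  by apply: val_inj; rewrite rho1 rz.
(* Over [r] the set is the singleton of [(val z).2], which forces the value of [q]. *)
by apply: (qs _ _ [set (val z).2] rho2); rewrite rz; exact: (set_valP z).
Qed.

(** A selection through a point of [O] is a plot, so it stays in [O] near [r0], and its values
    witness that the nearby sets still meet [O]. *)
Lemma Dopen_meets (R : realType) (X : Type) (DX : diffeology R X) (O : set X) :
  Dopen DX O -> Dopen (strong_powerset_diffeology DX) [set A | A `&` O !=set0].
Proof.
move=> oO n P sP; rewrite openE => r0 [A0 Pr0 [x0 [A0x0 Ox0]]].
have [q [pq qP qr0 qs]] := strong_plot_selection _ _ _ _ _ _ _ _ sP Pr0 A0x0.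
apply: filterS (open_nbhs_nbhs (conj (oO _ _ pq) _)); last by exists x0.
move=> r [x qr Ox]; have : dom P r by apply: qP; rewrite /dom /= qr.
rewrite /dom /=; case Pr : (P r) => [A|]// _.
by exists A => //; exists x; split=> //; exact: qs Pr.
Qed.

Theorem proposition4p4 (R : realType) (X : Type) (DX : diffeology R X) :
  strong_embedding DX (strong_powerset_diffeology DX) (fun x : X => [set x]).
Proof.
have ind := is_induction_set1 _ _ DX.
split=> //; first exact: diffeological_immersion_set1.
split=> [|O|O oO]; first exact: ind.1.
  by apply: smooth_Dcontinuous; exact: smooth_set1.
(* A singleton meets [O] exactly when its point is in [O], so this set cuts out the image of [O] in
   the range. *)
exists [set A | A `&` O !=set0]; first exact: Dopen_meets.
apply/seteqP; split=> [A [x Ox <-]|A [[x _ <-] [y [-> Oy]]]]; last by exists x.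
by split; [exists x|exists x].
Qed.
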